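(* For every real Banach space $X$ with $\dim X\ge 2$ and every $\lambda\in[0,1]$, $$J_\lambda^\perp(X)\le 1-2\min\{\lambda,1-\lambda\}\,\delta_X(1).$$
   Context: For a real Banach space $X$, $S_X=\{x\in X:\|x\|=1\}$. For $x,y\in X$, $x\perp_B y$ (Birkhoff--James orthogonality) means $\|x\|\le\|x+ty\|$ for every $t\in\mathbb R$. For $\lambda\in[0,1]$, $$J_\lambda^\perp(X)=\sup\{\min\{\|\lambda x+(1-\lambda)y\|,\|\lambda x-(1-\lambda)y\|\}: x,y\in S_X,\ x\perp_B y\}.$$ For $\epsilon\in[0,2]$ the modulus of convexity is $$\delta_X(\epsilon)=\inf\left\{1-\frac{\|x+y\|}{2}: x,y\in S_X,\ \|x-y\|\ge\epsilon\right\}.$$ *)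

(* Defs.v *)
From HB Require Import structures.
From mathcomp Require Import all_boot all_order all_algebra.
From mathcomp Require Import all_classical all_reals all_analysis.
Set Implicit Arguments.
Unset Strict Implicit.
Unset Printing Implicit Defensive.
Import Order.TTheory GRing.Theory Num.Theory.
Import numFieldNormedType.Exports.
Local Open Scope classical_set_scope.
Local Open Scope ring_scope.

(* X need not be finite-dimensional, so dim X >= 2 is stated as the existence
   of two linearly independent vectors. *)
Definition dim_ge2 (R : realType) (X : normedModType R) : Prop :=
  exists u v : X, forall a b : R, a *: u + b *: v = 0 -> a = 0 /\ b = 0.

Definition unit_sphere (R : realType) (X : normedModType R) : set X :=
  [set x | `|x| = 1].

Definition bj_orthogonal (R : realType) (X : normedModType R) (x y : X) : Prop :=
  forall t : R, `|x| <= `|x + t *: y|.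

(* [sup] and [inf] are the real-valued ones, with junk value 0 on sets that are
   empty or unbounded. The set below lies in [0, 1] for 0 <= lambda <= 1, and is
   nonempty when dim X >= 2. *)
Definition J_perp (R : realType) (X : normedModType R) (lambda : R) : R :=
  sup [set r | exists x y : X,
    [/\ unit_sphere x, unit_sphere y, bj_orthogonal x y &
        r = Num.min `|lambda *: x + (1 - lambda) *: y|
                    `|lambda *: x - (1 - lambda) *: y|]].

(* The set below lies in [0, 1], and is nonempty when X is nonzero and
   epsilon <= 2 (take y = - x). *)
Definition modulus_convexity (R : realType) (X : normedModType R)
    (epsilon : R) : R :=
  inf [set r | exists x y : X,
    [/\ unit_sphere x, unit_sphere y, epsilon <= `|x - y| &
        r = 1 - `|x + y| / 2]].

(* Main.v *)
Require Import Defs.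
From HB Require Import structures.
From mathcomp Require Import all_boot all_order all_algebra.
From mathcomp Require Import all_classical all_reals all_analysis.
From mathcomp Require Import lra.
Import Order.TTheory GRing.Theory Num.Theory.
Import numFieldNormedType.Exports.
Local Open Scope ring_scope.

(** Taking [t = -1] in the definition of [x] being orthogonal to [y] gives
    [1 <= `|x - y|], so the pair [(x, y)] competes in the infimum defining the
    modulus of convexity at [1], and [`|x + y| <= 2 (1 - delta)]
    ([norm_add_le_modulus]). With [m] the smaller of the two weights, the convex
    combination [lambda x + (1 - lambda) y] is [m (x + y)] plus a multiple of a
    unit vector by [1 - 2 m], so its norm is at most
    [2 m (1 - delta) + (1 - 2 m) = 1 - 2 m delta] ([norm_convex_le]). This
    already bounds the first of the two norms in the minimum, hence every
    element of the set whose supremum is [J_perp]. A supremum over the empty set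
    would be [0], which the right-hand side dominates because [delta <= 1] and
    [2 m <= 1]. *)

Lemma modulus_convexity_le (R : realType) (X : normedModType R) (eps : R)
    (x y : X) :
  `|x| = 1 -> `|y| = 1 -> eps <= `|x - y| ->
  modulus_convexity X eps <= 1 - `|x + y| / 2.
Proof.
move=> x1 y1 xy; apply: ge_inf; last by exists x, y.
exists 0 => _ [u [v [u1 v1 _ ->]]].
rewrite /unit_sphere /= in u1 v1.
have := ler_normD u v; lra.
Qed.

Lemma modulus_convexity_le1 (R : realType) (X : normedModType R) (eps : R) :
  modulus_convexity X eps <= 1.
Proof.
rewrite /modulus_convexity; set A := (X in inf X).
have [->|/set0P[_ [x [y [x1 y1 xy _]]]]] := eqVneq A set0; first by rewrite inf0.
apply: le_trans (modulus_convexity_le _ _ _ _ _ x1 y1 xy) _.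
have := normr_ge0 (x + y); lra.
Qed.

Lemma norm_add_le_modulus (R : realType) (X : normedModType R) (x y : X) :
  `|x| = 1 -> `|y| = 1 -> bj_orthogonal x y ->
  `|x + y| <= 2 * (1 - modulus_convexity X 1).
Proof.
move=> x1 y1 xy.
have xy1 : 1 <= `|x - y| by have := xy (-1); rewrite scaleN1r x1.
have := modulus_convexity_le _ _ _ _ _ x1 y1 xy1; lra.
Qed.

(** The part of the combination carried by equal weights is a multiple of
    [x + y]; the rest is a nonnegative multiple of a single unit vector. *)
Lemma norm_convex_le (R : realType) (X : normedModType R) (x y : X)
    (l : R) :
  0 <= l -> l <= 1 -> `|x| = 1 -> `|y| = 1 ->
  `|l *: x + (1 - l) *: y|
    <= Num.min l (1 - l) * `|x + y| + (1 - 2 * Num.min l (1 - l)).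
Proof.
move=> l0 l1 x1 y1.
have [lh|lh] := leP l (1 - l).
  have -> : l *: x + (1 - l) *: y = l *: (x + y) + (1 - 2 * l) *: y.
    by rewrite scalerDr -addrA -scalerDl; congr (_ + _ *: _); lra.
  apply: le_trans (ler_normD _ _) _.
  by rewrite !normrZ y1 mulr1 !ger0_norm //; lra.
have -> : l *: x + (1 - l) *: y = (1 - l) *: (x + y) + (1 - 2 * (1 - l)) *: x.
  by rewrite scalerDr addrAC -scalerDl; congr (_ *: _ + _); lra.
apply: le_trans (ler_normD _ _) _.
by rewrite !normrZ x1 mulr1 !ger0_norm //; lra.
Qed.

Theorem theorem3p13 (R : realType) (X : completeNormedModType R)
    (hdim : dim_ge2 X) (lambda : R) (hlambda0 : 0 <= lambda)
    (hlambda1 : lambda <= 1) :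
  J_perp X lambda <= 1 - 2 * Num.min lambda (1 - lambda) * modulus_convexity X 1.
Proof.
have d1 := modulus_convexity_le1 _ X 1.
set m := Num.min _ _; set d := modulus_convexity X 1 in d1 *.
have m0 : 0 <= m by rewrite /m le_min; lra.
have m2 : 2 * m <= 1 by rewrite /m; case: (leP lambda) => ?; lra.
rewrite /J_perp; set A := (X in sup X).
have [->|/set0P A0] := eqVneq A set0; first by rewrite sup0; nra.
apply: ge_sup => // _ [x [y [x1 y1 xy ->]]].
rewrite ge_min; apply/orP; left.
apply: le_trans (norm_convex_le _ _ _ _ _ hlambda0 hlambda1 x1 y1) _.
have := norm_add_le_modulus _ _ _ _ x1 y1 xy.
rewrite -/m -/d; nra.
Qed.
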